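(* Let $p\ge2$ be an integer and let $R=(R[0],\dots,R[p-1])$ be a $p$-fibred rational function with domain $A$, $\mathbb{Z}_p\subseteq A\subseteq\mathbb{Q}_p$, that is closed and avoiding. Assume that $R[r](\mathbb{Z}_p)\subseteq\mathbb{Z}_p$ for every $r\in\{0,\dots,p-1\}$ and that the $p$-fibred function $F:=(R[0]|_{\mathbb{Z}_p},\dots,R[p-1]|_{\mathbb{Z}_p})$, with entries regarded as functions $\mathbb{Z}_p\to\mathbb{Z}_p$, is a $p$-adic system in weak canonical form. Let $D$ be a finite sequence of length at least $1$ with entries in $\{0,\dots,p-1\}$. Then the function $R_D:A\to\mathbb{Q}_p$ has a unique fixed point in $\mathbb{Z}_p$.
   Context: $p\ge2$ is an integer, not necessarily prime. $\mathbb{Z}_p=\varprojlim \mathbb{Z}/p^k\mathbb{Z}$; every $a\in\mathbb{Z}_p$ is uniquely $a=\sum_{i\ge0}a_ip^i$ with $a_i\in\{0,\dots,p-1\}$, and $a\,\%\,p:=a_0$. $\mathbb{Q}_p=\mathbb{Z}_p[1/p]$. A $p$-fibred function with domain $\mathbb{Z}_p$ is a $p$-tuple $F=(F[0],\dots,F[p-1])$ of functions $F[r]:\mathbb{Z}_p\to\mathbb{Z}_p$, regarded also as a function $F:\mathbb{Z}_p\to\mathbb{Z}_p$ by $F(n)=\dfrac{F[n\%p](n)-(F[n\%p](n)\,\%\,p)}{p}$. The $F$-digit expansion of $n$ is $(F^k(n)\,\%\,p)_{k\ge0}$. $F$ is a $p$-adic system if for all integers $k\ge0$ and all $m,n\in\mathbb{Z}_p$: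 $m\equiv n\pmod{p^k}$ if and only if the first $k$ entries of the $F$-digit expansions of $m$ and $n$ coincide. $F$ is in weak canonical form if $F[r](r+p\mathbb{Z}_p)\subseteq p\mathbb{Z}_p$ for all $r\in\{0,\dots,p-1\}$. A $p$-fibred rational function with domain $A\subseteq\mathbb{Q}_p$ is a $p$-tuple $R=(R[0],\dots,R[p-1])$ of functions $R[r]:A\to\mathbb{Q}_p$. It is closed if $R[r](x)/p\in A$ for all $r\in\{0,\dots,p-1\}$ and $x\in A$. It is avoiding if for every $r\in\{0,\dots,p-1\}$: $R[r]\big((\mathbb{Q}_p\setminus(r+p\mathbb{Z}_p))\cap A\big)\cap p\mathbb{Z}_p=\emptyset$. For closed $R$ and a finite sequence $D=(d_0,\dots,d_{k-1})$ with entries in $\{0,\dots,p-1\}$, the function $R_D:A\to\mathbb{Q}_p$ is defined recursively by $R_{()}(x)=x$ and $R_{(d_0,\dots,d_{k-1})}(x)=R[d_{k-1}]\big(R_{(d_0,\dots,d_{k-2})}(x)\big)/p$ for $k\ge1$. *)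

(* Defs.v *)
From HB Require Import structures.
From mathcomp Require Import all_boot all_order all_algebra generic_quotient ring.
From mathcomp Require Import boolp classical_sets.

Set Implicit Arguments.
Unset Strict Implicit.
Unset Printing Implicit Defensive.

Import Order.TTheory GRing.Theory Num.Theory.

Local Open Scope ring_scope.
Local Open Scope quotient_scope.
Local Open Scope classical_set_scope.

(* The inverse limit of the rings Z/p^k: an element is a coherent sequence of
   residues, the residue mod p^k being its canonical representative in int.
   No assumption on p is needed for the ring structure; with the conventions
   of modz, p = 1 gives the zero ring and p = 0 gives Z. *)
Record padic_int (p : nat) := PadicInt {
  padic_res : nat -> int;
  padic_resP : forall k,
    padic_res k = (padic_res k.+1 %% p%:Z ^+ k)%Z
}.

HB.instance Definition _ (p : nat) := gen_eqMixin (padic_int p).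
HB.instance Definition _ (p : nat) := gen_choiceMixin (padic_int p).

Section PadicIntRing.
Variable p : nat.
Implicit Types x y z : padic_int p.

Lemma padic_int_eq x y : padic_res x =1 padic_res y -> x = y.
Proof.
case: x y => [f Hf] [g Hg] /= /funext fg.
by subst g; congr PadicInt; apply: Prop_irrelevance.
Qed.

Lemma padic_res_mod x k : (padic_res x k %% p%:Z ^+ k)%Z = padic_res x k.
Proof. by rewrite [in LHS]padic_resP modz_mod -padic_resP. Qed.

Fact padic_mk_subproof (g : nat -> int) :
    (forall k, (g k.+1 = g k %[mod p%:Z ^+ k])%Z) ->
  forall k, (g k %% p%:Z ^+ k)%Z = ((g k.+1 %% p%:Z ^+ k.+1)%Z %% p%:Z ^+ k)%Z.
Proof.
move=> Hg k; rewrite -Hg {1}(divz_eq (g k.+1) (p%:Z ^+ k.+1)).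
by rewrite exprS mulrA modzMDl.
Qed.

Definition padic_mk (g : nat -> int)
    (Hg : forall k, (g k.+1 = g k %[mod p%:Z ^+ k])%Z) : padic_int p :=
  PadicInt (padic_mk_subproof Hg).

Fact padic_zero_subproof k : (0 = 0 %[mod p%:Z ^+ k])%Z.
Proof. by []. Qed.
Definition padic_zero := padic_mk padic_zero_subproof.

Fact padic_one_subproof k : (1 = 1 %[mod p%:Z ^+ k])%Z.
Proof. by []. Qed.
Definition padic_one := padic_mk padic_one_subproof.

Fact padic_opp_subproof x k :
  (- padic_res x k.+1 = - padic_res x k %[mod p%:Z ^+ k])%Z.
Proof. by rewrite (padic_resP x k) modzNm. Qed.
Definition padic_opp x := padic_mk (padic_opp_subproof x).

Fact padic_add_subproof x y k :
  (padic_res x k.+1 + padic_res y k.+1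
   = padic_res x k + padic_res y k %[mod p%:Z ^+ k])%Z.
Proof. by rewrite (padic_resP x k) (padic_resP y k) modzDm. Qed.
Definition padic_add x y := padic_mk (padic_add_subproof x y).

Fact padic_mul_subproof x y k :
  (padic_res x k.+1 * padic_res y k.+1
   = padic_res x k * padic_res y k %[mod p%:Z ^+ k])%Z.
Proof. by rewrite (padic_resP x k) (padic_resP y k) modzMm. Qed.
Definition padic_mul x y := padic_mk (padic_mul_subproof x y).

Fact padic_addA : associative padic_add.
Proof.
by move=> x y z; apply: padic_int_eq => k /=; rewrite modzDml modzDmr addrA.
Qed.

Fact padic_addC : commutative padic_add.
Proof. by move=> x y; apply: padic_int_eq => k /=; rewrite addrC. Qed.

Fact padic_add0 : left_id padic_zero padic_add.
Proof.
by move=> x; apply: padic_int_eq => k /=; rewrite modzDml add0r padic_res_mod.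
Qed.

Fact padic_addN : left_inverse padic_zero padic_opp padic_add.
Proof.
by move=> x; apply: padic_int_eq => k /=; rewrite modzDml addNr.
Qed.

HB.instance Definition _ :=
  GRing.isZmodule.Build (padic_int p) padic_addA padic_addC padic_add0 padic_addN.

Fact padic_mulA : associative padic_mul.
Proof.
by move=> x y z; apply: padic_int_eq => k /=; rewrite modzMml modzMmr mulrA.
Qed.

Fact padic_mulC : commutative padic_mul.
Proof. by move=> x y; apply: padic_int_eq => k /=; rewrite mulrC. Qed.

Fact padic_mul1 : left_id padic_one padic_mul.
Proof.
by move=> x; apply: padic_int_eq => k /=; rewrite modzMml mul1r padic_res_mod.
Qed.

Fact padic_mulDl : left_distributive padic_mul padic_add.
Proof.
by move=> x y z; apply: padic_int_eq => k /=; rewrite modzMml modzDm mulrDl.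
Qed.

HB.instance Definition _ :=
  GRing.Zmodule_isComPzRing.Build (padic_int p)
    padic_mulA padic_mulC padic_mul1 padic_mulDl.

Lemma padic_resD x y k :
  padic_res (x + y) k = ((padic_res x k + padic_res y k) %% p%:Z ^+ k)%Z.
Proof. by []. Qed.

Lemma padic_resM x y k :
  padic_res (x * y) k = ((padic_res x k * padic_res y k) %% p%:Z ^+ k)%Z.
Proof. by []. Qed.

Lemma padic_resN x k : padic_res (- x) k = (- padic_res x k %% p%:Z ^+ k)%Z.
Proof. by []. Qed.

Lemma padic_res_nat (n k : nat) :
  padic_res (n%:R : padic_int p) k = (n%:Z %% p%:Z ^+ k)%Z.
Proof.
elim: n => [//|n IHn].
by rewrite -addn1 natrD padic_resD IHn modzDm PoszD.
Qed.

(* If x = \sum_i x_i p^i with digits x_i, this is \sum_i x_(i+1) p^i. It is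
   the quotient x / p when p divides x, see padic_quoM. *)
Fact padic_quo_subproof x k :
  ((padic_res x k.+2 %/ p)%Z = (padic_res x k.+1 %/ p)%Z %[mod p%:Z ^+ k])%Z.
Proof.
have [->|p0] := eqVneq p%:Z 0; first by rewrite !divz0.
rewrite (padic_resP x k.+1) {1}(divz_eq (padic_res x k.+2) (p%:Z ^+ k.+1)).
by rewrite exprSr mulrA divzMDl // modzMDl.
Qed.
Definition padic_quo x := padic_mk (padic_quo_subproof x).

Lemma padic_quo_eq x : (0 < p)%N ->
  x = (`|padic_res x 1|%N)%:R + p%:R * padic_quo x.
Proof.
move=> p0; have p0' : p%:Z != 0 by rewrite -lt0n.
apply: padic_int_eq => k.
rewrite padic_resD padic_resM !padic_res_nat /= modzMml modzMmr modzDm.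
rewrite -(padic_res_mod x k) [in LHS](padic_resP x k) modz_mod.
rewrite {1}(divz_eq (padic_res x k.+1) p) addrC [(p : int) * _]mulrC.
congr ((_ + _) %% _)%Z.
have x1_ge0 : 0 <= padic_res x 1 by rewrite -padic_res_mod expr1 modz_ge0.
rewrite gez0_abs //; elim: k => [|k IHk]; last first.
  rewrite -IHk [in RHS](padic_resP x k.+1).
  rewrite {1}(divz_eq (padic_res x k.+2) (p%:Z ^+ k.+1)).
  by rewrite exprSr mulrA modzMDl.
by rewrite -[RHS]padic_res_mod expr1.
Qed.

Lemma padic_quoM x : (0 < p)%N -> padic_quo (p%:R * x) = x.
Proof.
move=> p0; have p0' : p%:Z != 0 by rewrite -lt0n.
apply: padic_int_eq => k /=; rewrite padic_res_nat modzMml.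
rewrite {1}[(p%:Z * _)%R]mulrC exprSr.
have -> : ((padic_res x k.+1 * p) %% (p%:Z ^+ k * p))%Z
          = (padic_res x k.+1 %% p%:Z ^+ k)%Z * p.
  rewrite [in LHS](divz_eq (padic_res x k.+1) (p%:Z ^+ k)) mulrDl -mulrA modzMDl.
  rewrite modz_small // mulr_ge0 ?modz_ge0 ?expf_neq0 //=.
  by rewrite ltr_pM2r ?ltz_pmod ?exprn_gt0 // ltz_nat.
by rewrite -padic_resP mulzK // padic_res_mod.
Qed.

Lemma padic_mulpI : (0 < p)%N -> injective (fun x => p%:R * x).
Proof. by move=> p0 x y /(congr1 padic_quo); rewrite !padic_quoM. Qed.

End PadicIntRing.

(* The localization of a commutative ring at the powers of one element;
   the pair (a, n) stands for the fraction a / f^n. *)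
Section Localization.
Variables (R : comPzRingType) (f : R).
Implicit Types x y z : R * nat.

Definition loc_rel x y : bool :=
  `[< exists s, f ^+ s * (f ^+ y.2 * x.1) = f ^+ s * (f ^+ x.2 * y.1) >].

Fact loc_rel_equiv : equiv_class_of loc_rel.
Proof.
split=> [x|x y|y x z].
- by apply/asboolP; exists 0%N.
- by apply/asboolP/asboolP => -[s Hs]; exists s.
- move=> /asboolP[s Hs] /asboolP[t Ht]; apply/asboolP.
  exists (s + t + y.2)%N; rewrite !exprD.
  transitivity (f ^+ t * f ^+ z.2 * (f ^+ s * (f ^+ y.2 * x.1))); first by ring.
  rewrite Hs.
  transitivity (f ^+ s * f ^+ x.2 * (f ^+ t * (f ^+ z.2 * y.1))); first by ring.
  by rewrite Ht; ring.
Qed.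

Canonical loc_equiv := EquivRelPack loc_rel_equiv.

Definition localization := {eq_quot loc_rel}.

HB.instance Definition _ := Choice.on localization.
HB.instance Definition _ := EqQuotient.on localization.

Lemma loc_eqP x y :
  reflect (exists s, f ^+ s * (f ^+ y.2 * x.1) = f ^+ s * (f ^+ x.2 * y.1))
    (x == y %[mod localization]).
Proof. by rewrite eqmodE; apply: asboolP. Qed.

Definition loc_frac (a : R) (n : nat) : localization := \pi_localization (a, n).

Lemma loc_fracP (u : localization) : exists a n, u = loc_frac a n.
Proof.
exists (repr u).1, (repr u).2; rewrite /loc_frac -surjective_pairing.
by rewrite reprK.
Qed.

Lemma loc_frac_eq a n b m :
  loc_frac a n = loc_frac b m <->
  exists s, f ^+ s * (f ^+ m * a) = f ^+ s * (f ^+ n * b).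
Proof. by split=> [/eqP/loc_eqP//|H]; apply/eqP/loc_eqP. Qed.

Definition loc_zero := loc_frac 0 0.
Definition loc_one := loc_frac 1 0.
Definition loc_opp (u : localization) := loc_frac (- (repr u).1) (repr u).2.
Definition loc_add (u v : localization) :=
  loc_frac (f ^+ (repr v).2 * (repr u).1 + f ^+ (repr u).2 * (repr v).1)
    ((repr u).2 + (repr v).2).
Definition loc_mul (u v : localization) :=
  loc_frac ((repr u).1 * (repr v).1) ((repr u).2 + (repr v).2).

Lemma loc_frac_repr a n :
  exists s, f ^+ s * (f ^+ n * (repr (loc_frac a n)).1)
            = f ^+ s * (f ^+ (repr (loc_frac a n)).2 * a).
Proof.
by apply/loc_frac_eq; rewrite /loc_frac -surjective_pairing reprK.
Qed.

Lemma loc_oppE a n : loc_opp (loc_frac a n) = loc_frac (- a) n.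
Proof.
have [s Hs] := loc_frac_repr a n; apply/loc_frac_eq; exists s.
by rewrite !mulrN Hs.
Qed.

Lemma loc_addE a n b m :
  loc_add (loc_frac a n) (loc_frac b m)
  = loc_frac (f ^+ m * a + f ^+ n * b) (n + m).
Proof.
have [s] := loc_frac_repr a n; have [t] := loc_frac_repr b m.
rewrite /loc_add; case: (repr _) => b' m' /= Ht; case: (repr _) => a' n' /= Hs.
apply/loc_frac_eq; exists (s + t)%N; rewrite !exprD.
transitivity (f ^+ t * f ^+ m * f ^+ m' * (f ^+ s * (f ^+ n * a'))
  + f ^+ s * f ^+ n * f ^+ n' * (f ^+ t * (f ^+ m * b'))); first by ring.
by rewrite Hs Ht; ring.
Qed.

Lemma loc_mulE a n b m :
  loc_mul (loc_frac a n) (loc_frac b m) = loc_frac (a * b) (n + m).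
Proof.
have [s] := loc_frac_repr a n; have [t] := loc_frac_repr b m.
rewrite /loc_mul; case: (repr _) => b' m' /= Ht; case: (repr _) => a' n' /= Hs.
apply/loc_frac_eq; exists (s + t)%N; rewrite !exprD.
transitivity ((f ^+ s * (f ^+ n * a')) * (f ^+ t * (f ^+ m * b'))); first by ring.
by rewrite Hs Ht; ring.
Qed.

Fact loc_addA : associative loc_add.
Proof.
move=> u v w; have [a [n ->]] := loc_fracP u; have [b [m ->]] := loc_fracP v.
have [c [l ->]] := loc_fracP w; rewrite !loc_addE addnA; congr loc_frac.
by rewrite !exprD; ring.
Qed.

Fact loc_addC : commutative loc_add.
Proof.
move=> u v; have [a [n ->]] := loc_fracP u; have [b [m ->]] := loc_fracP v.
by rewrite !loc_addE addnC addrC.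
Qed.

Fact loc_add0 : left_id loc_zero loc_add.
Proof.
move=> u; have [a [n ->]] := loc_fracP u.
by rewrite loc_addE mulr0 expr0 add0r mul1r.
Qed.

Fact loc_addN : left_inverse loc_zero loc_opp loc_add.
Proof.
move=> u; have [a [n ->]] := loc_fracP u.
rewrite loc_oppE loc_addE; apply/loc_frac_eq; exists 0%N => /=.
by rewrite mulrN addNr !mulr0.
Qed.

HB.instance Definition _ :=
  GRing.isZmodule.Build localization loc_addA loc_addC loc_add0 loc_addN.

Fact loc_mulA : associative loc_mul.
Proof.
move=> u v w; have [a [n ->]] := loc_fracP u; have [b [m ->]] := loc_fracP v.
by have [c [l ->]] := loc_fracP w; rewrite !loc_mulE addnA mulrA.
Qed.

Fact loc_mulC : commutative loc_mul.
Proof.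
move=> u v; have [a [n ->]] := loc_fracP u; have [b [m ->]] := loc_fracP v.
by rewrite !loc_mulE addnC mulrC.
Qed.

Fact loc_mul1 : left_id loc_one loc_mul.
Proof. by move=> u; have [a [n ->]] := loc_fracP u; rewrite loc_mulE mul1r. Qed.

Fact loc_mulDl : left_distributive loc_mul loc_add.
Proof.
move=> u v w; have [a [n ->]] := loc_fracP u; have [b [m ->]] := loc_fracP v.
have [c [l ->]] := loc_fracP w; rewrite !(loc_mulE, loc_addE).
by apply/loc_frac_eq; exists 0%N; rewrite !exprD; ring.
Qed.

HB.instance Definition _ :=
  GRing.Zmodule_isComPzRing.Build localization
    loc_mulA loc_mulC loc_mul1 loc_mulDl.

Definition loc_embed (a : R) : localization := loc_frac a 0.

Definition loc_inv : localization := loc_frac 1 1.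

Fact loc_embed_is_zmod_morphism : zmod_morphism loc_embed.
Proof.
move=> a b; rewrite -[RHS]/(loc_add _ (loc_opp _)) loc_oppE loc_addE.
by rewrite !mul1r.
Qed.

HB.instance Definition _ := GRing.isZmodMorphism.Build R localization loc_embed
  loc_embed_is_zmod_morphism.

Fact loc_embed_is_monoid_morphism : monoid_morphism loc_embed.
Proof. by split=> // a b; rewrite -[RHS]/(loc_mul _ _) loc_mulE. Qed.

HB.instance Definition _ := GRing.isMonoidMorphism.Build R localization loc_embed
  loc_embed_is_monoid_morphism.

Lemma loc_embedV : loc_embed f * loc_inv = 1.
Proof.
rewrite -[LHS]/(loc_mul _ _) loc_mulE; apply/loc_frac_eq; exists 0%N.
by rewrite /= mulr1 mul1r.
Qed.

Lemma loc_fracE a n : loc_frac a n = loc_embed a * loc_inv ^+ n.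
Proof.
elim: n => [|n IHn]; first by rewrite expr0 mulr1.
rewrite exprSr mulrA -IHn -[RHS]/(loc_mul _ _) loc_mulE.
by rewrite mulr1 addn1.
Qed.

End Localization.

Definition padic_rat (p : nat) := localization (p%:R : padic_int p).
HB.instance Definition _ (p : nat) := GRing.ComPzRing.on (padic_rat p).

Section PadicRat.
Variable p : nat.

Definition padic_embed : padic_int p -> padic_rat p := loc_embed p%:R.
HB.instance Definition _ := GRing.RMorphism.on padic_embed.

(* padic_rat p is only declared as a ring, so x / p is written x * padic_pinv. *)
Definition padic_pinv : padic_rat p := loc_inv p%:R.

Lemma padic_pinvP : p%:R * padic_pinv = 1 :> padic_rat p.
Proof. by rewrite -[RHS](loc_embedV p%:R) rmorph_nat. Qed.

Lemma padic_ratP (u : padic_rat p) :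
  exists a n, u = padic_embed a * padic_pinv ^+ n.
Proof. by have [a [n ->]] := loc_fracP u; exists a, n; rewrite loc_fracE. Qed.

Lemma padic_embed_inj : (0 < p)%N -> injective padic_embed.
Proof.
move=> p0 a b /loc_frac_eq[s]; rewrite expr0 !mul1r.
elim: s => [|s IHs]; first by rewrite expr0 !mul1r.
by rewrite !exprS -!mulrA => /(padic_mulpI p0)/IHs.
Qed.

End PadicRat.

Arguments padic_pinv {p}.

Section PadicSystems.
Variables (p : nat) (p_gt1 : (1 < p)%N).

(* The digit a_0 of a is the image of a in Z/p, see padic_quo_eq. *)
Fact padic_digit_subproof (x : padic_int p) : (`|padic_res x 1|%N < p)%N.
Proof.
have p0 : p%:Z != 0 by case: p p_gt1.
have <- : (padic_res x 1 %% p%:Z)%Z = padic_res x 1.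
  by rewrite -[RHS]padic_res_mod.
by rewrite -ltz_nat gez0_abs ?modz_ge0 // ltz_pmod // ltz_nat ltnW.
Qed.

Definition padic_digit (x : padic_int p) : 'I_p :=
  Ordinal (padic_digit_subproof x).

Definition padic_eqmod (k : nat) (m n : padic_int p) : Prop :=
  exists c, m - n = p%:R ^+ k * c.

Definition fibred_fun (F : 'I_p -> padic_int p -> padic_int p)
    (n : padic_int p) : padic_int p :=
  let y := F (padic_digit n) n in padic_quo (y - (padic_digit y)%:R).

Definition digit_expansion (F : 'I_p -> padic_int p -> padic_int p)
    (n : padic_int p) (k : nat) : 'I_p :=
  padic_digit (iter k (fibred_fun F) n).

Definition padic_system (F : 'I_p -> padic_int p -> padic_int p) : Prop :=
  forall (k : nat) (m n : padic_int p),
    padic_eqmod k m n <->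
    (forall i, (i < k)%N -> digit_expansion F m i = digit_expansion F n i).

End PadicSystems.

Section FibredRational.
Variable p : nat.

(* r + p Z_p inside Z_p; r = 0 gives p Z_p. *)
Definition padic_class (r : nat) : set (padic_int p) :=
  [set r%:R + p%:R * y | y in setT].

Definition weak_canonical (F : 'I_p -> padic_int p -> padic_int p) : Prop :=
  forall r : 'I_p, F r @` padic_class r `<=` padic_class 0.

Definition Zp_set : set (padic_rat p) := range (@padic_embed p).

Definition Zp_class (r : nat) : set (padic_rat p) :=
  @padic_embed p @` padic_class r.

(* A p-fibred rational function with domain A is represented by total
   functions on Q_p of which only the values on A are used. *)
Implicit Types (R : 'I_p -> padic_rat p -> padic_rat p) (A : set (padic_rat p)).

Definition fibred_closed A R : Prop :=
  forall (r : 'I_p) x, A x -> A (R r x * padic_pinv).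

Definition fibred_avoiding A R : Prop :=
  forall r : 'I_p, R r @` (~` Zp_class r `&` A) `&` Zp_class 0 = set0.

(* foldl consumes d_0 first, so d_(k-1) is applied last. *)
Definition fibred_iter R (D : seq 'I_p) (x : padic_rat p) : padic_rat p :=
  foldl (fun y d => R d y * padic_pinv) x D.

(* The restriction of R r to Z_p read as a function Z_p -> Z_p; meaningful
   when R r maps Zp_set into itself. *)
Definition fibred_restr R (r : 'I_p) (x : padic_int p) : padic_int p :=
  xget 0 [set y | padic_embed y = R r (padic_embed x)].

End FibredRational.

Arguments Zp_set p : clear implicits.

(* Main.v *)
Require Import Defs.
From mathcomp Require Import all_boot all_order all_algebra.
From mathcomp Require Import boolp classical_sets.

(** The F-digit expansion is a bijection from Z_p onto the infinite words: it
    is injective modulo p^k for every k, hence onto the words of length k by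
    counting, and Z_p is complete. On Z_p, weak canonical form identifies R_D
    with the |D|-th iterate of F at the points whose expansion begins with D.
    So the point with expansion DDD... is fixed. Conversely, if R_D x = x lies
    in Z_p then, going backwards through the orbit of x, avoidance forces each
    intermediate point into Z_p with the digit prescribed by D; hence the
    expansion of x is DDD... *)

Import GRing.Theory.

Local Open Scope ring_scope.
Local Open Scope classical_set_scope.

Lemma PoszX (m k : nat) : (m ^ k)%N%:Z = m%:Z ^+ k.
Proof. by rewrite -!natz natrX. Qed.

Section PadicInt.
Context {p : nat} (p_gt1 : (1 < p)%N).
Implicit Types (x y : padic_int p) (k : nat).

Let p_gt0 : (0 < p)%N. Proof. exact: ltnW. Qed.

(** By induction on [k]: a vanishing residue mod [p^(k+1)] makes the first digit vanish, so [x] is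
    [p] times [padic_quo x], whose residue mod [p^k] vanishes in turn. *)
Lemma padic_res_eq0P x k :
  padic_res x k = 0 <-> exists c, x = p%:R ^+ k * c.
Proof.
split=> [|[c ->]]; last first.
  by rewrite -natrX padic_resM padic_res_nat PoszX modzz mul0r mod0z.
elim: k x => [|k IHk] x xk0; first by exists x; rewrite mul1r.
have x10 : padic_res x 1 = 0.
  elim: k xk0 {IHk} => [//|k IHk] xk0.
  by apply: IHk; rewrite padic_resP xk0 mod0z.
have [|c xc] := IHk (padic_quo x); first by rewrite /= xk0 div0z mod0z.
by exists c; rewrite (padic_quo_eq x p_gt0) x10 add0r exprS -mulrA -xc.
Qed.

Lemma padic_eqmodP k x y : padic_eqmod k x y <-> padic_res x k = padic_res y k.
Proof.
apply: (iff_trans (iff_sym (padic_res_eq0P (x - y) k))).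
rewrite padic_resD padic_resN modzDmr; split=> [xy|->]; last first.
  by rewrite subrr mod0z.
rewrite -[LHS]padic_res_mod -[RHS]padic_res_mod; apply/eqP.
by rewrite eqz_mod_dvd; apply/dvdz_mod0P.
Qed.

Lemma padic_digitD (r : 'I_p) y : padic_digit p_gt1 (r%:R + p%:R * y) = r.
Proof.
suff res1 : padic_res (r%:R + p%:R * y) 1 = r :> int.
  by apply: val_inj; rewrite /padic_digit [LHS](congr1 absz res1).
rewrite padic_resD padic_resM !padic_res_nat !expr1.
by rewrite modzz mul0r mod0z addr0 modz_mod modz_small // ltz_nat ltn_ord.
Qed.

Lemma padic_digitM y : padic_digit p_gt1 (p%:R * y) = Ordinal p_gt0.
Proof. by rewrite -(padic_digitD (Ordinal p_gt0) y) add0r. Qed.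

Lemma padic_class_digit x : padic_class (padic_digit p_gt1 x) x.
Proof. by exists (padic_quo x) => //; rewrite -padic_quo_eq. Qed.

End PadicInt.

Section DigitExpansion.
Context {p : nat} (p_gt1 : (1 < p)%N).
Variable F : 'I_p -> padic_int p -> padic_int p.
Hypothesis F_system : padic_system p_gt1 F.

Lemma digit_expansion_inj (x y : padic_int p) :
  digit_expansion p_gt1 F x =1 digit_expansion p_gt1 F y -> x = y.
Proof.
move=> xy; apply: padic_int_eq => k.
by apply/(padic_eqmodP p_gt1)/F_system => i _; apply: xy.
Qed.

Lemma digit_expansion_prefix_surj (k : nat) (w : nat -> 'I_p) :
  exists x, forall i, (i < k)%N -> digit_expansion p_gt1 F x i = w i.
Proof.
(* The naturals below [p^k] are pairwise incongruent mod [p^k], and there are as many of them as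
   words of length [k]. *)
pose f (a : 'I_(p ^ k)) :=
  [ffun i : 'I_k => digit_expansion p_gt1 F (a : nat)%:R i].
have f_inj : injective f.
  move=> a b fab; apply: val_inj.
  have /F_system/(padic_eqmodP p_gt1) : forall i, (i < k)%N ->
      digit_expansion p_gt1 F (a : nat)%:R i
      = digit_expansion p_gt1 F (b : nat)%:R i.
    by move=> i ik; move/ffunP/(_ (Ordinal ik)): fab; rewrite !ffunE.
  rewrite !padic_res_nat -PoszX !modz_small ?ltz_nat ?ltn_ord //.
  by case.
have : [ffun i : 'I_k => w i] \in codom f.
  by apply: inj_card_onto => //; rewrite card_ffun !card_ord.
case/codomP=> a wa; exists (a : nat)%:R => i ik.
by move/ffunP/(_ (Ordinal ik)): wa; rewrite !ffunE.
Qed.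

Lemma digit_expansion_surj (w : nat -> 'I_p) :
  exists x, digit_expansion p_gt1 F x =1 w.
Proof.
have [u uw] := choice (fun k => digit_expansion_prefix_surj k w).
have u_res k : padic_res (u k.+1) k = padic_res (u k) k.
  apply/(padic_eqmodP p_gt1)/F_system => i ik.
  by rewrite !uw // ltnS ltnW.
have u_coherent k :
    (padic_res (u k.+1) k.+1 = padic_res (u k) k %[mod p%:Z ^+ k])%Z.
  by rewrite -padic_resP u_res padic_res_mod.
exists (padic_mk u_coherent) => k.
(* Entry [k] is determined mod [p^(k+1)], so the limit is compared with [u k.+1], not [u k]. *)
rewrite -(uw k.+1 k (ltnSn k)).
apply: (proj1 (F_system k.+1 _ _)) (ltnSn k).
by apply/(padic_eqmodP p_gt1); rewrite /= padic_res_mod.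
Qed.

Lemma digit_expansion_iter (n i : nat) (x : padic_int p) :
  digit_expansion p_gt1 F (iter n (fibred_fun p_gt1 F) x) i
  = digit_expansion p_gt1 F x (i + n).
Proof. by rewrite /digit_expansion iterD. Qed.

Lemma digit_expansion_modn (n : nat) (x : padic_int p) :
  iter n (fibred_fun p_gt1 F) x = x ->
  forall i, digit_expansion p_gt1 F x i = digit_expansion p_gt1 F x (i %% n).
Proof.
move=> xn i; rewrite {1}(divn_eq i n) addnC -digit_expansion_iter.
by rewrite iterM iter_fix.
Qed.

End DigitExpansion.

Section FibredRational.
Context {p : nat} (p_gt1 : (1 < p)%N).
Variables (A : set (padic_rat p)) (R : 'I_p -> padic_rat p -> padic_rat p).
Hypotheses (R_closed : fibred_closed A R) (R_avoiding : fibred_avoiding A R).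
Hypothesis R_Zp : forall r : 'I_p, R r @` Zp_set p `<=` Zp_set p.
Hypothesis F_weak_canonical : weak_canonical (fibred_restr R).

Let F := fibred_fun p_gt1 (fibred_restr R).

(** [R_Zp] makes the set searched by [xget] inhabited, so the default value 0 is not what is
    returned. *)
Lemma fibred_restrE (r : 'I_p) (x : padic_int p) :
  padic_embed (fibred_restr R r x) = R r (padic_embed x).
Proof.
have [|y _ yRx] := R_Zp r (R r (padic_embed x)).
  by exists (padic_embed x) => //; exists x.
exact: (@xgetPex _ 0 [set y | padic_embed y = R r (padic_embed x)]
          (ex_intro _ y yRx)).
Qed.

Lemma padic_embedMpK (y : padic_int p) :
  padic_embed (p%:R * y) * padic_pinv = padic_embed y.
Proof. by rewrite rmorphM rmorph_nat mulrAC padic_pinvP mul1r. Qed.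

(** Weak canonical form makes the digit subtracted in [fibred_fun] zero, so that [F] is plain
    division by [p], as in one step of [fibred_iter]. *)
Lemma embed_fibred_fun (x : padic_int p) :
  padic_embed (F x) = R (padic_digit p_gt1 x) (padic_embed x) * padic_pinv.
Proof.
have [|y _] := F_weak_canonical (padic_digit p_gt1 x)
  (fibred_restr R (padic_digit p_gt1 x) x).
  by exists x => //; apply: padic_class_digit.
rewrite add0r -fibred_restrE /F /fibred_fun => <-.
by rewrite padic_digitM subr0 padic_quoM ?padic_embedMpK // ltnW.
Qed.

Lemma fibred_iter_embed (d : 'I_p) (D : seq 'I_p) (x : padic_int p) :
  (forall i, (i < size D)%N ->
     digit_expansion p_gt1 (fibred_restr R) x i = nth d D i) ->
  fibred_iter R D (padic_embed x) = padic_embed (iter (size D) F x).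
Proof.
elim: D x => [//|e D IHD] x xD.
have <- : padic_digit p_gt1 x = e by apply: (xD 0%N).
rewrite /fibred_iter /= -embed_fibred_fun -iterS iterSr; apply: IHD => i iD.
rewrite (digit_expansion_iter _ _ 1) addn1.
exact: (xD i.+1).
Qed.

(** The backward step of uniqueness. The starting point ranges over [A] because the next orbit
    point, to which the induction hypothesis is applied, is at first only known to lie in [A], by
    closedness. *)
Lemma fibred_iter_Zp (d : 'I_p) (D : seq 'I_p) (x : padic_rat p) :
  A x -> Zp_set p (fibred_iter R D x) ->
  exists2 y, x = padic_embed y & forall i, (i < size D)%N ->
    digit_expansion p_gt1 (fibred_restr R) y i = nth d D i.
Proof.
elim: D x => [|e D IHD] x Ax; first by case=> y _ yx; exists y.
move=> /(IHD _ (R_closed e _ Ax))[y' Rxy' y'D].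
(* Since [R e x / p] is the integer [y'], the value [R e x] lies in [pZ_p]; avoidance then excludes
   [x] outside [e + pZ_p]. *)
have Rx0 : Zp_class 0 (R e x).
  exists (p%:R * y'); first by exists y' => //; rewrite add0r.
  by rewrite rmorphM rmorph_nat /= -Rxy' mulrCA padic_pinvP mulr1.
have [y [z _ yz] xy] : Zp_class e x.
  apply: contrapT => xe.
  suff : set0 (R e x) by [].
  by rewrite -(R_avoiding e); split=> //; exists x.
exists y => // i; have ye : padic_digit p_gt1 y = e.
  by rewrite -yz padic_digitD.
case: i => [//|i] iD; rewrite -addn1 -digit_expansion_iter addn1 /= -y'D //.
(* It remains to see that [F y = y']: the expansion of [y] is [e] followed by that of [y']. *)
congr digit_expansion; apply: (padic_embed_inj (ltnW p_gt1)).
by rewrite embed_fibred_fun ye xy.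
Qed.

End FibredRational.

Theorem theorem5p11 (p : nat) (p_ge2 : (2 <= p)%N)
    (A : set (padic_rat p)) (R : 'I_p -> padic_rat p -> padic_rat p)
    (Zp_sub_A : Zp_set p `<=` A)
    (R_closed : fibred_closed A R)
    (R_avoiding : fibred_avoiding A R)
    (R_Zp : forall r : 'I_p, R r @` Zp_set p `<=` Zp_set p)
    (F_system : padic_system p_ge2 (fibred_restr R))
    (F_weak_canonical : weak_canonical (fibred_restr R))
    (D : seq 'I_p) (D_length : (1 <= size D)%N) :
  exists! x : padic_rat p, Zp_set p x /\ fibred_iter R D x = x.
Proof.
(* The digit 0, as default for [nth]; all indices used stay below [size D]. *)
pose d := Ordinal (ltnW p_ge2).
have iterE := @fibred_iter_embed p p_ge2 R R_Zp F_weak_canonical d D.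
have [x xD] := digit_expansion_surj p_ge2 _ F_system
  (fun i => nth d D (i %% size D)).
have xD' i : (i < size D)%N ->
    digit_expansion p_ge2 (fibred_restr R) x i = nth d D i.
  by move=> iD; rewrite xD modn_small.
exists (padic_embed x); split.
  split; first by exists x.
  rewrite iterE //; congr padic_embed.
  apply: (digit_expansion_inj p_ge2 _ F_system) => i.
  (* Iterating [F] [size D] times drops one full period of the expansion. *)
  by rewrite digit_expansion_iter !xD modnDr.
move=> u [uZ uD].
have [|y uy yD] := @fibred_iter_Zp p p_ge2 A R R_closed R_avoiding R_Zp
  F_weak_canonical d D u (Zp_sub_A u uZ); first by rewrite uD.
rewrite uy; congr padic_embed.
apply: (digit_expansion_inj p_ge2 _ F_system) => i.
(* The expansion of [y] begins with [D], so [R_D] acts on [y] as this iterate; being fixed, [y] has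
   a periodic expansion. *)
have y_fix : iter (size D) (fibred_fun p_ge2 (fibred_restr R)) y = y.
  by apply: (padic_embed_inj (ltnW p_ge2)); rewrite -iterE // -uy.
by rewrite xD (digit_expansion_modn _ _ _ _ y_fix) yD // ltn_mod.
Qed.
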